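(* Let $G$ be a finite group and $L_S(G)=\{H\in L(G): H \text{ is solvable}\}$. If $S=(G\times G)\sqcup L_S(G)$, then \[ {\Pr}_{\mathrm{sol}}(G)=\frac{\sum_{H\in L_S(G)}\deg_{\mathcal{B}(G)[S]}(H)}{|G|^2}=\frac{|e(\mathcal{B}(G)[S])|}{|G|^2}. \]
   Context: For a group $G$, let $L(G)$ be the set of all subgroups of $G$. The graph $\mathcal{B}(G)$ is the simple undirected bipartite graph with vertex set the disjoint union $V(\mathcal{B}(G)) = (G\times G) \sqcup L(G)$, in which $(a,b)\in G\times G$ and $H \in L(G)$ are adjacent if and only if $H = \langle a,b\rangle$, and there are no other edges. For $S\subseteq V(\mathcal{B}(G))$, $\mathcal{B}(G)[S]$ is the subgraph of $\mathcal{B}(G)$ induced by $S$; $e(\Gamma)$ is the edge set of a graph $\Gamma$ and $\deg_\Gamma$ the degree in $\Gamma$. (The subscript in $L_S(G)$ is part of the notation and unrelated to the set $S$.) ${\Pr}_{\mathrm{sol}}(G)=\dfrac{|\{(a,b)\in G\times G: \langle a,b\rangle \text{ is solvable}\}|}{|G|^2}$ is the solvability degree of $G$. *)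

(* Defs.v *)
From HB Require Import structures.
From mathcomp Require Import all_boot all_order all_algebra all_fingroup all_solvable.
Set Implicit Arguments.
Unset Strict Implicit.
Unset Printing Implicit Defensive.
Import GroupScope.

Record sgraph (T : finType) := SGraph {
  vertices : {set T};
  adj : rel T;
  adj_sym : symmetric adj;
  adj_irr : irreflexive adj;
  adj_vertices : forall x y, adj x y -> (x \in vertices) && (y \in vertices)
}.

Section Graphs.
Variables (T : finType) (Gamma : sgraph T).

Definition edges : {set {set T}} :=
  [set [set p.1; p.2] | p in [set p : T * T | adj Gamma p.1 p.2]].

Definition deg (x : T) : nat := #|[set y | adj Gamma x y]|.

Variable S : {set T}.

Definition induced_adj : rel T :=
  fun x y => [&& x \in S, y \in S & adj Gamma x y].

Fact induced_sym : symmetric induced_adj.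
Proof. by move=> x y; rewrite /induced_adj adj_sym andbCA. Qed.

Fact induced_irr : irreflexive induced_adj.
Proof. by move=> x; rewrite /induced_adj adj_irr !andbF. Qed.

Fact induced_vertices x y :
  induced_adj x y ->
  (x \in vertices Gamma :&: S) && (y \in vertices Gamma :&: S).
Proof.
by case/and3P=> xS yS /adj_vertices/andP[xV yV]; rewrite !inE xS yS xV yV.
Qed.

(* S need not be contained in the vertex set: its part outside is ignored. *)
Definition induced : sgraph T :=
  SGraph induced_sym induced_irr induced_vertices.

End Graphs.

Definition disjoint_union (T1 T2 : finType) (A : {set T1}) (B : {set T2}) :
    {set T1 + T2} :=
  [set z | match z with inl x => x \in A | inr y => y \in B end].

Section GeneratingGraph.
Variables (gT : finGroupType) (G : {group gT}).

Local Notation vertex := ((gT * gT) + {group gT})%type.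

Definition generates (p : gT * gT) (H : {group gT}) : bool :=
  (p \in setX G G) && (H :==: <<[set p.1; p.2]>>).

Definition generating_adj : rel vertex := fun x y =>
  match x, y with
  | inl p, inr H => generates p H
  | inr H, inl p => generates p H
  | _, _ => false
  end.

Fact generating_sym : symmetric generating_adj.
Proof. by case=> [p|H] [q|K]. Qed.

Fact generating_irr : irreflexive generating_adj.
Proof. by case. Qed.

Definition generating_vertices : {set vertex} :=
  disjoint_union (setX G G) (subgroups G).

Lemma generates_sub p H : generates p H -> H \subset G.
Proof.
case/andP; rewrite inE => /andP[aG bG] /eqP->.
by rewrite gen_subG subUset !sub1set aG.
Qed.

Fact generating_adj_vertices x y :
  generating_adj x y -> (x \in generating_vertices) && (y \in generating_vertices).
Proof.
by case: x y => [p|H] [q|K] //= gen; rewrite !in_set (generates_sub gen) ?andbT;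
  case/andP: gen; rewrite inE.
Qed.

Definition generating_graph : sgraph vertex :=
  SGraph generating_sym generating_irr generating_adj_vertices.

Definition solvable_subgroups : {set {group gT}} :=
  [set H in subgroups G | solvable H].

Definition Pr_sol : rat :=
  (#|[set p in setX G G | solvable <<[set p.1; p.2]>>]|%:R
     / (#|G|%:R ^+ 2))%R.

End GeneratingGraph.

(* Main.v *)
(** Every pair [(a, b)] of elements of [G] is adjacent to exactly one subgroup,
    namely [<<a, b>>], which lies in [L_S(G)] iff it is solvable.  So both the
    edges of the induced graph and the incidences counted by the degree sum are
    in bijection with the pairs generating a solvable subgroup. *)
Require Import Defs.
From mathcomp Require Import all_boot all_order all_algebra all_fingroup all_solvable.
Import GroupScope.

(** The set counted by the numerator of [Pr_sol]; degree sum and edge count are both compared with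
    it. *)
Definition solvable_pairs {gT : finGroupType} (G : {group gT}) : {set gT * gT} :=
  [set p in setX G G | solvable <<[set p.1; p.2]>>].

Definition solvable_part {gT : finGroupType} (G : {group gT}) :
    {set (gT * gT) + {group gT}} :=
  disjoint_union (setX G G) (solvable_subgroups G).

Definition pair_edge {gT : finGroupType} (p : gT * gT) :
    {set (gT * gT) + {group gT}} :=
  [set inl p; inr <<[set p.1; p.2]>>%G].

Section SolvablePart.
Variables (gT : finGroupType) (G : {group gT}).

Local Notation Gamma := (induced (generating_graph G) (solvable_part G)).

Lemma generatesE p (H : {group gT}) :
  generates G p H = (p \in setX G G) && (<<[set p.1; p.2]>>%G == H).
Proof. by rewrite /generates [_ == H]eq_sym. Qed.

(** As [H] is the subgroup generated by [p], its solvability becomes a condition on [p], and its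
    inclusion in [G] is automatic. *)
Lemma adj_solvable_partE p (H : {group gT}) :
  adj Gamma (inl p) (inr H) =
    (p \in solvable_pairs G) && (<<[set p.1; p.2]>>%G == H).
Proof.
rewrite /= /induced_adj /= generatesE /solvable_pairs !in_set.
have [<-|_] := eqVneq; last by rewrite !andbF.
have [/andP[aG bG]|//] := boolP ((p.1 \in G) && (p.2 \in G)).
by rewrite gen_subG subUset !sub1set aG bG !andbT.
Qed.

Lemma deg_solvable_part (H : {group gT}) :
  deg Gamma (inr H) =
    #|[set p in solvable_pairs G | <<[set p.1; p.2]>>%G == H]|.
Proof.
have inl_inj : injective (@inl (gT * gT) {group gT}) by move=> x y [].
(* By bipartiteness all neighbours of [inr H] have the form [inl p], so the pairs are counted
   through their image under [inl]. *)
rewrite -(card_imset _ inl_inj) /deg; congr #|pred_of_set _|.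
apply/setP=> -[p|K]; rewrite inE.
  by rewrite mem_imset // inE adj_sym adj_solvable_partE.
rewrite /= /induced_adj /= !andbF.
by apply/esym/negP => /imsetP[].
Qed.

(** The map sending a pair to the subgroup it generates partitions [solvable_pairs G] into fibres,
    whose sizes are the degrees. *)
Lemma sum_deg_solvable_part :
  \sum_(H in solvable_subgroups G) deg Gamma (inr H) = #|solvable_pairs G|.
Proof.
rewrite -sum1_card (partition_big (fun p => <<[set p.1; p.2]>>%G)
  [in solvable_subgroups G]) /= => [|p].
  by apply: eq_bigr => H _; rewrite deg_solvable_part -sum1dep_card.
rewrite !inE => /andP[/andP[aG bG] ->].
by rewrite gen_subG subUset !sub1set aG bG.
Qed.

(** An edge has a single endpoint of the form [inl p], which recovers [p]. *)
Lemma pair_edge_inj : injective (@pair_edge gT).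
Proof.
move=> p q /setP/(_ (inl p)); rewrite !inE eqxx /= orbF.
by move/esym/eqP=> -[].
Qed.

Lemma edges_solvable_part :
  edges Gamma = pair_edge @: solvable_pairs G.
Proof.
apply/setP=> e; apply/imsetP/imsetP => [[[x y]]|[p Pp ->]]; last first.
  exists (inl p, inr <<[set p.1; p.2]>>%G) => //.
  by rewrite inE adj_solvable_partE Pp eqxx.
rewrite inE /=; case: x y => [p|H] [q|K] xy ->.
- by move: xy; rewrite /induced_adj !andbF.
- move: xy; rewrite -[induced_adj _ _ _ _]/(adj Gamma _ _) adj_solvable_partE.
  by case/andP=> Pp /eqP <-; exists p.
(* The reverse orientation gives the same unordered edge. *)
- move: xy; rewrite -[induced_adj _ _ _ _]/(adj Gamma _ _) adj_sym.
  by rewrite adj_solvable_partE => /andP[Pq /eqP <-]; exists q; rewrite // setUC.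
- by move: xy; rewrite /induced_adj !andbF.
Qed.

Lemma card_edges_solvable_part : #|edges Gamma| = #|solvable_pairs G|.
Proof. by rewrite edges_solvable_part card_imset //; apply: pair_edge_inj. Qed.

End SolvablePart.

Theorem theorem3p7 (gT : finGroupType) (G : {group gT})
    (S : {set (gT * gT) + {group gT}}) :
  S = disjoint_union (setX G G) (solvable_subgroups G) ->
  Pr_sol G =
    ((\sum_(H in solvable_subgroups G)
        deg (induced (generating_graph G) S) (inr H))%N%:R
       / (#|G|%:R ^+ 2))%R
  /\
  ((\sum_(H in solvable_subgroups G)
      deg (induced (generating_graph G) S) (inr H))%N%:R
     / (#|G|%:R ^+ 2))%R
  = (#|edges (induced (generating_graph G) S)|%:R / (#|G|%:R ^+ 2))%R :> rat.
Proof.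
(* All three numerators are now the size of [solvable_pairs G], for [Pr_sol] by unfolding. *)
by move=> ->; rewrite sum_deg_solvable_part card_edges_solvable_part.
Qed.
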